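(* Let $A\in\mathbb{R}^{n\times n}$ be Metzler and let $E\in\mathbb{R}^{n\times q}$, $C\in\mathbb{R}^{q\times n}$, $F\in\mathbb{R}^{q\times q}$ be entrywise nonnegative. Let $q=q_1+\dots+q_N$ and $$\boldsymbol{\Delta}^{2}:=\{\Delta=\mathrm{diag}(\Delta_1,\ldots,\Delta_N):\ \Delta_i\in\mathbb{C}^{q_i\times q_i},\ \|\Delta_i\|_2\le 1\},\qquad \mathcal{D}_\Delta:=\{\mathrm{diag}(d_1I_{q_1},\ldots,d_NI_{q_N}):\ d_i>0\}.$$ Consider the uncertain system $\dot x=Ax+Ew$, $z=Cx+Fw$, $w=\Delta z$. The following statements are equivalent: (i) The uncertain system is asymptotically stable for all $\Delta\in\boldsymbol{\Delta}^{2}$. (ii) There exist $\lambda,\mu\in\mathbb{R}^n_{>0}$, $\nu\in\mathbb{R}^q_{>0}$ and $D\in\mathcal{D}_\Delta$ such that $A\lambda+E\nu<0$ and $$\begin{bmatrix}\lambda\\ \nu\end{bmatrix}^T\begin{bmatrix}C^TDC & C^TDF\\ F^TDC & F^TDF-D\end{bmatrix}+\mu^T\begin{bmatrix}A & E\end{bmatrix}<0 .$$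
   Context: A real matrix is Metzler if all its off-diagonal entries are nonnegative. $\|\cdot\|_2$ is the matrix norm induced by the Euclidean vector norm. Vector inequalities are componentwise. The uncertain system is asymptotically stable for a given $\Delta$ if $I-F\Delta$ is invertible and $A+E\Delta(I-F\Delta)^{-1}C$ is Hurwitz stable. *)

(* Defs.v *)
From HB Require Import structures.
From mathcomp Require Import all_boot all_order all_algebra.
From mathcomp Require Import reals.
From mathcomp Require Export complex.
Set Implicit Arguments. Unset Strict Implicit. Unset Printing Implicit Defensive.
Import Order.TTheory GRing.Theory Num.Theory.
Local Open Scope ring_scope.

Section Defs.
Variable R : realType.

Definition metzler n (A : 'M[R]_n) : Prop :=
  forall i j : 'I_n, i != j -> 0 <= A i j.

Definition nonneg_mx m n (M : 'M[R]_(m, n)) : Prop :=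
  forall i j, 0 <= M i j.

Definition pos_mx m n (M : 'M[R]_(m, n)) : Prop := forall i j, 0 < M i j.
Definition neg_mx m n (M : 'M[R]_(m, n)) : Prop := forall i j, M i j < 0.

Definition cplx_mx m n (M : 'M[R]_(m, n)) : 'M[R[i]]_(m, n) :=
  map_mx (fun x => x%:C%C) M.

Definition sqnorm2 n (v : 'cV[R[i]]_n) : R :=
  \sum_(k < n) ((complex.Re (v k 0)) ^+ 2 + (complex.Im (v k 0)) ^+ 2).

Definition l2norm_le1 n (M : 'M[R[i]]_n) : Prop :=
  forall v : 'cV[R[i]]_n, sqnorm2 (M *m v) <= sqnorm2 v.

Definition hurwitz n (M : 'M[R[i]]_n) : Prop :=
  forall a : R[i], eigenvalue M a -> complex.Re a < 0.

Definition Delta2 N (qs : 'I_N -> nat) (Delta : 'M[R[i]]_(\sum_i qs i)) : Prop :=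
  exists Ds : forall i : 'I_N, 'M[R[i]]_(qs i),
    (forall i, l2norm_le1 (Ds i)) /\ Delta = \mxdiag_(i < N) Ds i.

Definition Dscal N (qs : 'I_N -> nat) (D : 'M[R]_(\sum_i qs i)) : Prop :=
  exists d : 'I_N -> R,
    (forall i, 0 < d i) /\ D = \mxdiag_(i < N) ((d i)%:M : 'M[R]_(qs i)).

Definition asymp_stable n q (A : 'M[R]_n) (E : 'M[R]_(n, q)) (C : 'M[R]_(q, n))
  (F : 'M[R]_q) (Delta : 'M[R[i]]_q) : Prop :=
  let M := 1%:M - cplx_mx F *m Delta in
  M \in unitmx /\
  hurwitz (cplx_mx A + cplx_mx E *m Delta *m invmx M *m cplx_mx C).

End Defs.

Arguments Delta2 {R N} qs Delta.
Arguments Dscal {R N} qs D.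

(* Main.v *)
Require Import Defs.
From HB Require Import structures.
From mathcomp Require Import all_boot all_order all_algebra.
From mathcomp Require Import boolp classical_sets reals topology normedtype derive.
From mathcomp Require Import complex ring lra.
Set Implicit Arguments. Unset Strict Implicit. Unset Printing Implicit Defensive.
Import Order.TTheory GRing.Theory Num.Theory.
Import numFieldNormedType.Exports.
Local Open Scope ring_scope.

(** (ii) => (i): with P = diag(mu_i / lam_i), the symmetric matrix
    Q = [C F]^T D [C F] - diag(0, D) + [PA + A^T P, PE; E^T P, 0] is Metzler and
    maps the positive vector (lam, nu) to a negative one, so it is negative
    definite; x^T P x is then a Lyapunov function for every Delta.

    (i) => (ii): put G = F - C A^-1 E >= 0. If some x >= 0, x != 0, had
    |x_i| <= |(G x)_i| for all blocks i, then rank one blocks Delta_i sending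
    (G x)_i to x_i would give the closed loop the eigenvalue 0 or make I - F Delta
    singular. Hence the vector of gains |(G x)_i|^2 - |x_i|^2 never lies in the
    nonnegative orthant. Since it is a concave function of (x_k^2)_k, a
    separation argument gives d_i > 0 with sum_i d_i (|(G x)_i|^2 - |x_i|^2) < 0,
    so G^T D G - D is Metzler and negative definite and some nu > 0 satisfies
    (G^T D G - D) nu < 0. Finally lam = -A^-1 (E nu + eps 1) and
    mu = -A^-T (C^T D (C lam + F nu) + eps 1) for a small eps > 0. *)

Lemma unitmx_ker0 (K : fieldType) n (B : 'M[K]_n) :
  (forall x : 'cV_n, B *m x = 0 -> x = 0) -> B \in unitmx.
Proof.
move=> Bker; rewrite -unitmx_tr -row_free_unit; apply: inj_row_free => v vB0.
by apply: trmx_inj; rewrite trmx0; apply: Bker; rewrite -[B]trmxK -trmx_mul vB0 trmx0.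
Qed.

(** * Metzler matrices and positive vectors that they map to negative ones *)

Section Metzler.
Variable R : realType.
Implicit Types n : nat.

Lemma metzler_tr n (B : 'M[R]_n) : metzler B -> metzler B^T.
Proof. by move=> mB i j nij; rewrite mxE; apply: mB; rewrite eq_sym. Qed.

Lemma metzler_shift n (B : 'M[R]_n) t : metzler B -> metzler (B - t%:M).
Proof. by move=> mB i j nij; rewrite !mxE (negPf nij) mulr0n subr0; apply: mB. Qed.

(** If [j] minimizes [x_j / lam_j], with ratio [th], then [x - th lam] is nonnegative and vanishes
    at [j], so row [j] gives [(B x)_j >= th (B lam)_j]. This is positive when [th < 0]. *)
Lemma metzler_monotone n (B : 'M[R]_n) (lam x : 'cV_n) :
  metzler B -> pos_mx lam -> neg_mx (B *m lam) ->
  (forall i, (B *m x) i 0 <= 0) -> nonneg_mx x.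
Proof.
move=> mB lam0 Blam Bx i c; rewrite (ord1 c) {c} leNgt; apply/negP => xi.
have [j _ minj] := Order.TotalTheory.arg_minP (i0 := i) (P := xpredT)
  (fun j => x j 0 / lam j 0) isT.
set th := x j 0 / lam j 0 in minj.
have th0 : th < 0 by apply: le_lt_trans (minj i isT) _; rewrite pmulr_llt0 ?invr_gt0.
have := Bx j; rewrite leNgt => /negP; apply.
apply: (@lt_le_trans _ _ (th * (B *m lam) j 0)); first by rewrite nmulr_rgt0.
rewrite !mxE mulr_sumr; apply: ler_sum => k _; rewrite mulrCA.
have [<-|njk] := eqVneq j k; first by rewrite divfK ?gt_eqF.
by apply: ler_wpM2l; [exact: mB | rewrite -ler_pdivlMr //; apply: minj].
Qed.

(** At an index where [x] vanishes, so does the diagonal term of that row of [B x], and the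
    off-diagonal terms are nonnegative. *)
Lemma metzler_pos n (B : 'M[R]_n) (x : 'cV_n) :
  metzler B -> nonneg_mx x -> neg_mx (B *m x) -> pos_mx x.
Proof.
move=> mB x0 Bx i c; rewrite (ord1 c) {c} lt_def x0 andbT; apply/eqP => xi.
have := Bx i 0; rewrite ltNge => /negP; apply.
rewrite mxE; apply: sumr_ge0 => k _.
have [<-|nik] := eqVneq i k; first by rewrite xi mulr0.
by apply: mulr_ge0; [exact: mB | exact: x0].
Qed.

Lemma metzler_monotone_pos n (B : 'M[R]_n) (lam x : 'cV_n) :
  metzler B -> pos_mx lam -> neg_mx (B *m lam) ->
  neg_mx (B *m x) -> pos_mx x.
Proof.
move=> mB lam0 Blam Bx; apply: (metzler_pos mB) => //.
by apply: (metzler_monotone mB lam0 Blam) => i; apply/ltW/Bx.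
Qed.

(** Monotonicity applies to both [x] and [- x] when [x] is in the kernel. *)
Lemma metzler_unit n (B : 'M[R]_n) (lam : 'cV_n) :
  metzler B -> pos_mx lam -> neg_mx (B *m lam) -> B \in unitmx.
Proof.
move=> mB lam0 Blam; apply: unitmx_ker0 => x Bx.
have x0 : nonneg_mx x.
  by apply: (metzler_monotone mB lam0 Blam) => i; rewrite Bx mxE.
have Nx0 : nonneg_mx (- x).
  by apply: (metzler_monotone mB lam0 Blam) => i; rewrite mulmxN Bx !mxE oppr0.
apply/matrixP => i j; rewrite mxE; apply/le_anti/andP; split; last exact: x0.
by have := Nx0 i j; rewrite mxE oppr_ge0.
Qed.

(* The infimum t0 of the shifts t making [A - t] stable must be 0: the solution x
   of (A - t0) x = -1 is nonnegative because (A - t) x <= 0 for t close to t0, so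
   x certifies t0 itself and even slightly smaller shifts. *)
Lemma metzler_shift_unit_pos n (A : 'M[R]_n) :
  metzler A -> (forall t, 0 <= t -> A - t%:M \in unitmx) ->
  exists2 lam : 'cV_n, pos_mx lam & neg_mx (A *m lam).
Proof.
move=> mA uA.
pose S : set R := fun t => 0 <= t /\ exists2 lam : 'cV_n, pos_mx lam & neg_mx ((A - t%:M) *m lam).
suff [_ [lam l0 Al]] : S 0 by exists lam => //; move: Al; rewrite raddf0 subr0.
have hS : has_inf S.
  split; last by exists 0 => t [].
  (* A shift above the sum of all absolute entries makes the all-ones vector a certificate, so [S]
     is nonempty. *)
  exists (1 + \sum_i \sum_j `|A i j|); split.
    by rewrite addr_ge0 // sumr_ge0 // => i _; rewrite sumr_ge0.
  exists (const_mx 1) => [i j|i c]; first by rewrite mxE.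
  rewrite mulmxBl mul_scalar_mx !mxE mulr1 subr_lt0.
  apply: le_lt_trans (_ : _ <= \sum_i \sum_j `|A i j|) _; last by rewrite ltrDr.
  rewrite [leRHS](bigD1 i) //= -[leLHS]addr0 lerD //; last first.
    by apply: sumr_ge0 => k _; apply: sumr_ge0.
  by apply: ler_sum => k _; rewrite mxE mulr1 ler_norm.
set t0 := inf S.
have t0_ge0 : 0 <= t0 by apply: lb_le_inf; [case: hS|move=> t []].
have t0_le t : S t -> t0 <= t by move=> St; apply: ge_inf => //; case: hS.
pose x := invmx (A - t0%:M) *m (const_mx (-1) : 'cV_n).
have Ax : (A - t0%:M) *m x = const_mx (-1) by rewrite mulKVmx ?uA.
(* [K] exceeds all [|x_i|], so shifts within [K^-1] of [t0] keep [(A - t) x] negative. *)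
pose K := 1 + \sum_i `|x i 0|.
have K0 : 0 < K by rewrite ltr_pwDl // sumr_ge0.
have xK i : `|x i 0| < K.
  apply: le_lt_trans (_ : _ <= \sum_i `|x i 0|) _; last by rewrite ltrDr.
  by rewrite (bigD1 i) //= lerDl sumr_ge0.
have Ash t i : ((A - t%:M) *m x) i 0 = -1 + (t0 - t) * x i 0.
  have -> : A - t%:M = (A - t0%:M) + (t0 - t)%:M by rewrite raddfB /= addrA subrK.
  by rewrite mulmxDl Ax mul_scalar_mx !mxE.
have shift_small i s : `|s| <= K^-1 -> `|s * x i 0| < 1.
  move=> sK; rewrite normrM -(mulVf (lt0r_neq0 K0)).
  apply: le_lt_trans (_ : _ <= K^-1 * `|x i 0|) _; first exact: ler_wpM2r.
  by rewrite ltr_pM2l ?invr_gt0.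
have x_gt0 : pos_mx x.
  apply: (@metzler_pos _ (A - t0%:M)); first exact: metzler_shift.
    have [t St tlt] : exists2 t, S t & t < t0 + K^-1.
      by apply: inf_adherent => //; rewrite invr_gt0.
    have t0t := t0_le t St; case: St => _ [lam l0 Al].
    apply: (metzler_monotone (metzler_shift t mA) l0 Al) => i.
    rewrite Ash; have := shift_small i (t - t0).
    rewrite ger0_norm ?subr_ge0 // lerBlDl => /(_ (ltW tlt)); rewrite ltr_norml; lra.
  by move=> i j; rewrite Ax mxE ltrN10.
pose t1 := Num.max 0 (t0 - K^-1).
have St1 : S t1.
  split; first by rewrite le_max lexx.
  exists x => // i c; rewrite (ord1 c) Ash.
  have t1t0 : t1 <= t0 by rewrite ge_max t0_ge0 gerBl invr_ge0 ltW.
  have : t0 - K^-1 <= t1 by rewrite le_max lexx orbT.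
  have := shift_small i (t0 - t1); rewrite ger0_norm ?subr_ge0 // ltr_norml; lra.
(* Minimality of [t0] rules out [t0 <= t0 - K^-1], so [t0 <= 0] and [t1 = 0]. *)
have := t0_le _ St1.
rewrite le_max => /orP[t00|]; last by rewrite lerBrDr gerDl leNgt invr_gt0 K0.
by move: St1; rewrite /t1 max_l // subr_le0 (le_trans t00) // invr_ge0 ltW.
Qed.

(* With u_i = x_i / v_i, the bound 2 u_i u_j <= u_i^2 + u_j^2 on the off-diagonal
   terms gives x^T Q x <= sum_i u_i^2 v_i (Q v)_i. *)
Lemma quad_metzler n (Q : 'M[R]_n) (v x : 'cV_n) :
  metzler Q -> Q^T = Q -> pos_mx v -> neg_mx (Q *m v) -> x != 0 ->
  (x^T *m Q *m x) 0 0 < 0.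
Proof.
move=> mQ sQ v0 Qv xN0.
pose u i := x i 0 / v i 0.
have xE i : x i 0 = u i * v i 0 by rewrite divfK ?gt_eqF.
have -> : (x^T *m Q *m x) 0 0 = \sum_i \sum_j x i 0 * Q i j * x j 0.
  rewrite mxE exchange_big; apply: eq_bigr => j _ /=.
  by rewrite mxE mulr_suml; apply: eq_bigr => i _; rewrite mxE.
apply: (@le_lt_trans _ _ (\sum_i \sum_j Q i j * (v i 0 * v j 0) * ((u i ^+ 2 + u j ^+ 2) / 2))).
  apply: ler_sum => i _; apply: ler_sum => j _; rewrite !xE.
  have -> : u i * v i 0 * Q i j * (u j * v j 0) = Q i j * (v i 0 * v j 0) * (u i * u j) by lra.
  have [->|nij] := eqVneq i j; first by rewrite le_eqVlt; apply/orP; left; apply/eqP; lra.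
  apply: ler_wpM2l; first by rewrite mulr_ge0 ?mQ // mulr_ge0 ?ltW.
  have := sqr_ge0 (u i - u j); lra.
have -> : \sum_i \sum_j Q i j * (v i 0 * v j 0) * ((u i ^+ 2 + u j ^+ 2) / 2)
  = \sum_i u i ^+ 2 * v i 0 * (Q *m v) i 0.
  have -> : \sum_i u i ^+ 2 * v i 0 * (Q *m v) i 0 =
      \sum_i \sum_j Q i j * (v i 0 * v j 0) * u i ^+ 2.
    apply: eq_bigr => i _; rewrite mxE mulr_sumr; apply: eq_bigr => j _; lra.
  set W := RHS.
  (* By symmetry of [Q], the [u_i^2] and [u_j^2] halves contribute equally. *)
  have W2 : W = \sum_i \sum_j Q i j * (v i 0 * v j 0) * u j ^+ 2.
    rewrite /W exchange_big; apply: eq_bigr => j _; apply: eq_bigr => i _.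
    by rewrite -{1}sQ mxE [v j 0 * _]mulrC.
  have -> : W = (W + W) / 2 by lra.
  rewrite {2}W2 -big_split /= mulr_suml; apply: eq_bigr => i _.
  rewrite -big_split /= mulr_suml; apply: eq_bigr => j _; lra.
have [i xi] : exists i, x i 0 != 0.
  apply/existsP; apply: contraNT xN0 => /existsPn x0.
  by apply/eqP/matrixP => i j; rewrite (ord1 j) mxE; have := x0 i; rewrite negbK => /eqP.
rewrite (bigD1 i) //=; apply: ltr_wnDr.
  apply: sumr_le0 => k _; apply: mulr_ge0_le0; last exact/ltW/Qv.
  by rewrite mulr_ge0 ?sqr_ge0 ?ltW.
rewrite pmulr_rlt0; first exact: Qv.
apply: mulr_gt0; last exact: v0.
by rewrite exprn_even_gt0 //= mulf_neq0 // invr_eq0 gt_eqF.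
Qed.
End Metzler.

Lemma sum_sqr_eq0 (R : realDomainType) (I : finType) (f : I -> R) :
  \sum_i f i ^+ 2 = 0 -> forall i, f i = 0.
Proof.
move=> s0 i; apply/eqP; rewrite -sqrf_eq0; apply/eqP; move: i isT.
by apply: psumr_eq0P s0 => i _; exact: sqr_ge0.
Qed.

(** * Block gains and their concavity in the squared coordinates *)

Section BlockGain.
Variables (R : realType) (q N : nat) (G : 'M[R]_q) (b : 'I_q -> 'I_N).

(** With [b] labelling each coordinate by its block, this is [|(G x)_i|^2 - |x_i|^2]. *)
Definition block_gain (x : 'cV[R]_q) i :=
  \sum_(k | b k == i) (((G *m x) k 0) ^+ 2 - (x k 0) ^+ 2).

Lemma block_gainZ a x i : block_gain (a *: x) i = a ^+ 2 * block_gain x i.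
Proof.
rewrite /block_gain mulr_sumr; apply: eq_bigr => k _.
by rewrite -scalemxAr !mxE !exprMn mulrBr.
Qed.

Lemma sum_block_gain (d : 'I_N -> R) x :
  \sum_i d i * block_gain x i =
  \sum_k d (b k) * (((G *m x) k 0) ^+ 2 - (x k 0) ^+ 2).
Proof.
rewrite [RHS](partition_big b xpredT) //=; apply: eq_bigr => i _.
by rewrite mulr_sumr; apply: eq_bigr => k /eqP ->.
Qed.

(** A segment in the squared coordinates, pulled back to nonnegative vectors. *)
Definition sqrt_mix (s t : R) (x y : 'cV[R]_q) : 'cV[R]_q :=
  \col_j Num.sqrt (s * x j 0 ^+ 2 + t * y j 0 ^+ 2).

Lemma sqr_sqrt_mix s t x y j : 0 <= s -> 0 <= t ->
  (sqrt_mix s t x y j 0) ^+ 2 = s * x j 0 ^+ 2 + t * y j 0 ^+ 2.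
Proof. by move=> s0 t0; rewrite mxE sqr_sqrtr // addr_ge0 // mulr_ge0 // sqr_ge0. Qed.

Lemma sqrt_mix_ge0 s t x y : nonneg_mx (sqrt_mix s t x y).
Proof. by move=> i j; rewrite mxE sqrtr_ge0. Qed.

Hypothesis G0 : nonneg_mx G.

(** The square expands into nonnegative multiples of [z_i z_j], and [sqrt (X_i X_j)] is concave in
    the squares [X]: this is Cauchy-Schwarz in the plane for each pair of indices. *)
Lemma sqr_mulmx_concave s t x y k : 0 <= s -> 0 <= t ->
  nonneg_mx x -> nonneg_mx y ->
  s * ((G *m x) k 0) ^+ 2 + t * ((G *m y) k 0) ^+ 2 <=
  ((G *m sqrt_mix s t x y) k 0) ^+ 2.
Proof.
move=> s0 t0 x0 y0.
have sqE (z : 'cV[R]_q) : ((G *m z) k 0) ^+ 2 =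
    \sum_i \sum_j G k i * G k j * (z i 0 * z j 0).
  rewrite expr2 mxE mulr_suml; apply: eq_bigr => i _.
  by rewrite mulr_sumr; apply: eq_bigr => j _; lra.
rewrite !sqE !mulr_sumr -big_split; apply: ler_sum => i _ /=.
rewrite !mulr_sumr -big_split; apply: ler_sum => j _ /=.
rewrite !(mulrCA _ (G k i * G k j)) -mulrDr; apply: ler_wpM2l.
  by rewrite mulr_ge0.
have mix0 l := sqrt_mix_ge0 s t x y l 0.
rewrite -ler_sqr ?nnegrE; last 2 first.
- by rewrite addr_ge0 // !mulr_ge0.
- by rewrite mulr_ge0.
rewrite exprMn !sqr_sqrt_mix // -subr_ge0.
set u := x i 0; set v := x j 0; set w := y i 0; set z := y j 0.
(* Lagrange's identity *)
have -> : (s * u ^+ 2 + t * w ^+ 2) * (s * v ^+ 2 + t * z ^+ 2)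
   - (s * (u * v) + t * (w * z)) ^+ 2 = s * t * (u * z - w * v) ^+ 2 by lra.
by rewrite mulr_ge0 ?sqr_ge0 // mulr_ge0.
Qed.

(** The subtracted squares are linear in the squared coordinates, so the concavity of [(G x)_k^2]
    carries over. *)
Lemma block_gain_concave s t x y i : 0 <= s -> 0 <= t ->
  nonneg_mx x -> nonneg_mx y ->
  s * block_gain x i + t * block_gain y i <= block_gain (sqrt_mix s t x y) i.
Proof.
move=> s0 t0 x0 y0; rewrite /block_gain !mulr_sumr -big_split.
apply: ler_sum => k _ /=; rewrite sqr_sqrt_mix //.
have := sqr_mulmx_concave k s0 t0 x0 y0; lra.
Qed.

End BlockGain.

(** * Continuity of pointwise combinations of real functions *)

Section ContinuousPointwise.
Variables (R : realType) (T : topologicalType).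
Local Open Scope classical_set_scope.

Lemma continuous_sum (I : finType) (P : pred I) (f : I -> T -> R) :
  (forall i, P i -> continuous (f i)) -> continuous (fun x => \sum_(i | P i) f i x).
Proof.
by move=> fc x; apply: (@continuous_big _ _ _ _ _ add_continuous) => i Pi {}x; exact: fc.
Qed.

Lemma continuous_sub (f g : T -> R) :
  continuous f -> continuous g -> continuous (fun x => f x - g x).
Proof. by move=> fc gc x; apply: continuousB; [exact: fc | exact: gc]. Qed.

Lemma continuous_sqr (f : T -> R) : continuous f -> continuous (fun x => f x ^+ 2).
Proof. by move=> fc x; apply: continuousM; exact: fc. Qed.

Lemma continuous_neg_part (f : T -> R) :
  continuous f -> continuous (fun x => Num.max 0 (- f x)).
Proof.
move=> fc x; apply: (@continuous_max _ _ (fun=> 0) (fun x => - f x)).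
  exact: cst_continuous.
by apply: continuousN; exact: fc.
Qed.

End ContinuousPointwise.

(** * Separation of the gain vectors from the nonnegative orthant *)

Section BlockGainSeparation.
Variables (R : realType) (q N : nat) (G : 'M[R]_q) (b : 'I_q -> 'I_N).
Local Open Scope classical_set_scope.

(** The nonnegative part of the unit sphere, whose squared coordinates fill the standard simplex.
    Compactness comes from the box; row vectors suit the compactness and extreme value theorems. *)
Definition simplex_sqrt : set 'rV[R]_q :=
  [set v : 'rV[R]_q | forall i, 0 <= v 0 i <= 1] `&`
  [set v : 'rV[R]_q | \sum_i (v 0 i) ^+ 2 = 1].

Lemma continuous_block_gain i :
  continuous (fun v : 'rV[R]_q => block_gain G b v^T i).
Proof.
apply: continuous_sum => k _; apply: (@continuous_sub _ _
  (fun v : 'rV[R]_q => (G *m v^T) k 0 ^+ 2) (fun v => v^T k 0 ^+ 2)); apply: continuous_sqr.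
  rewrite (_ : (fun _ => _) = (fun v : 'rV[R]_q => \sum_j v 0 j * G k j)); last first.
    by apply/funext => w; rewrite mxE; apply: eq_bigr => j _; rewrite mxE mulrC.
  apply: continuous_sum => j _ v; apply: continuousM; last exact: cst_continuous.
  exact: coord_continuous.
rewrite (_ : (fun _ => _) = (fun v : 'rV[R]_q => v 0 k)); first exact: coord_continuous.
by apply/funext => w; rewrite mxE.
Qed.

Lemma compact_simplex_sqrt : compact simplex_sqrt.
Proof.
apply: compact_closedI.
  have := (@rV_compact R q (fun=> `[(0 : R), (1 : R)]%classic) (fun=> @segment_compact R 0 1)).
  congr compact; apply/funext => v; apply/propext; by split=> vI i; have := vI i; rewrite /= in_itv.
have sc : continuous (fun v : 'rV[R]_q => \sum_i (v 0 i) ^+ 2).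
  apply: continuous_sum => k _.
  by apply: (@continuous_sqr _ _ (fun v : 'rV[R]_q => v 0 k)); exact: coord_continuous.
exact: (@preimage_closed _ _ (fun v : 'rV[R]_q => \sum_i (v 0 i) ^+ 2)
  _ (fun v _ => sc v) (@closed_eq R 1)).
Qed.

(** Squared distance from the gain vector to the nonnegative orthant. *)
Definition defect (x : 'cV[R]_q) := \sum_i (Num.max 0 (- block_gain G b x i)) ^+ 2.

Lemma continuous_defect : continuous (fun v : 'rV[R]_q => defect v^T).
Proof.
apply: continuous_sum => i _; apply: continuous_sqr; apply: continuous_neg_part.
exact: continuous_block_gain.
Qed.

Lemma simplex_sqrtP (x : 'cV[R]_q) : nonneg_mx x -> \sum_i x i 0 ^+ 2 = 1 ->
  simplex_sqrt x^T.
Proof.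
move=> x0 x1; split=> [i|]; last by rewrite /= -[RHS]x1; apply: eq_bigr => i _; rewrite mxE.
rewrite mxE x0 /= -(ler_pXn2r (n := 2)) ?nnegrE // expr1n -x1 (bigD1 i) //= lerDl.
by apply: sumr_ge0 => k _; apply: sqr_ge0.
Qed.

Hypothesis G0 : nonneg_mx G.
Hypothesis noGain : forall x : 'cV[R]_q, nonneg_mx x ->
  (forall i, 0 <= block_gain G b x i) -> x = 0.

(* Nearest point argument: [d] is the negative part of the gain vector at the
   minimizer [c] of its squared norm. Moving from [c] towards [x] in the squared
   coordinates cannot decrease the defect, and concavity turns the first order
   condition into sum_i d_i gain_i(x) <= - sum_i d_i^2. *)
Lemma block_gain_separation_sphere : (0 < q)%N -> exists2 d : 'I_N -> R, (forall i, 0 <= d i) &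
  forall x : 'cV[R]_q, nonneg_mx x -> \sum_i x i 0 ^+ 2 = 1 ->
    \sum_i d i * block_gain G b x i < 0.
Proof.
move=> q0.
have S0 : simplex_sqrt !=set0.
  exists (delta_mx 0 (Ordinal q0)); split=> [i|] /=.
    by rewrite mxE ler0n lern1 leq_b1.
  rewrite (bigD1 (Ordinal q0)) //= mxE !eqxx expr1n big1 ?addr0 // => i /negPf ni.
  by rewrite mxE ni andbF expr0n.
have [c] := EVT_min_rV S0 compact_simplex_sqrt (continuous_subspaceT continuous_defect).
rewrite inE => -[c01 c1] cmin.
have c0 : nonneg_mx c^T by move=> i j; rewrite mxE (ord1 j); have /andP[] := c01 i.
pose d i := Num.max 0 (- block_gain G b c^T i).
have d0 i : 0 <= d i by rewrite le_max lexx.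
exists d => // x x0 x1.
(* If [d] were zero, all gains at [c] would be nonnegative and [noGain] would give [c = 0], off the
   sphere. *)
have sd : 0 < \sum_i d i ^+ 2.
  rewrite lt_def sumr_ge0 ?andbT => [|i _]; last exact: sqr_ge0.
  apply/eqP => sd0; have c'0 : c^T = 0.
    apply: noGain => // i; rewrite -oppr_le0; apply: le_trans (_ : _ <= d i) _.
      by rewrite le_max lexx orbT.
    by rewrite (sum_sqr_eq0 sd0).
  move: c1; rewrite /= big1 => [/esym/eqP|i _]; first by rewrite oner_eq0.
  by rewrite -[c]trmxK c'0 !mxE expr0n.
pose h i := d i + block_gain G b x i.
suff : \sum_i d i * h i <= 0.
  rewrite (eq_bigr (fun i => d i ^+ 2 + d i * block_gain G b x i)); last first.
    by move=> i _; rewrite mulrDr expr2.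
  by rewrite big_split /=; lra.
have key t : 0 <= t -> t <= 1 -> \sum_i d i ^+ 2 <= \sum_i (d i - t * h i) ^+ 2.
  move=> t0 t1; have s0 : 0 <= 1 - t by rewrite subr_ge0.
  pose y := sqrt_mix (1 - t) t c^T x.
  have Sy : simplex_sqrt y^T.
    apply: simplex_sqrtP; first exact: sqrt_mix_ge0.
    under eq_bigr do rewrite sqr_sqrt_mix //.
    rewrite big_split -!mulr_sumr x1 (eq_bigr (fun i => c 0 i ^+ 2)).
      by rewrite c1 !mulr1 /= subrK.
    by move=> i _; rewrite mxE.
  have := cmin y^T; rewrite inE trmxK => /(_ Sy) /le_trans; apply.
  apply: ler_sum => i _.
  (* Concavity gives [- gain(y) <= (1 - t) d_i - t gain(x)], and the right side is [d_i - t h_i]. *)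
  have r_ge : - block_gain G b y i <= d i - t * h i.
    have := block_gain_concave b G0 i s0 t0 c0 x0.
    have : - block_gain G b c^T i <= d i by rewrite le_max lexx orbT.
    move=> /(ler_wpM2l s0); rewrite -/y /h; move: (d i) (block_gain G b c^T i) => di bc.
    lra.
  have [y0|y0] := leP (- block_gain G b y i) 0; first by rewrite expr0n sqr_ge0.
  by rewrite lerXn2r ?nnegrE ?(ltW y0) ?(le_trans (ltW y0)) //.
set s1 := \sum_i _; rewrite leNgt; apply/negP => s1_gt0.
pose s2 := \sum_i h i ^+ 2; have s2_ge0 : 0 <= s2 by apply: sumr_ge0 => i _; exact: sqr_ge0.
have quad t : \sum_i (d i - t * h i) ^+ 2 = \sum_i d i ^+ 2 - 2 * t * s1 + t ^+ 2 * s2.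
  rewrite /s1 /s2 !mulr_sumr -sumrN -!big_split /=; apply: eq_bigr => i _; lra.
(* Adding [s1] to the denominator keeps [t <= 1] and avoids division by zero; [t s2 = s1 - t s1]
   then contradicts [2 s1 <= t s2]. *)
pose t := s1 / (s1 + s2); have s12 : 0 < s1 + s2 by rewrite ltr_wpDr.
have t_gt0 : 0 < t by rewrite divr_gt0.
have tE : t * (s1 + s2) = s1 by rewrite divfK ?gt_eqF.
have t1 : t <= 1 by rewrite ler_pdivrMr // mul1r lerDl.
have := key t (ltW t_gt0) t1; rewrite quad => le1.
have : 2 * s1 <= t * s2 by rewrite -(ler_pM2l t_gt0); lra.
have : 0 < t * s1 by rewrite mulr_gt0.
lra.
Qed.

(** Homogeneity extends the sphere result to all nonzero nonnegative [x]; it remains to make the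
    weights strictly positive. *)
Lemma block_gain_separation : exists2 d : 'I_N -> R, (forall i, 0 < d i) &
  forall x : 'cV[R]_q, nonneg_mx x -> x != 0 ->
    \sum_k d (b k) * (((G *m x) k 0) ^+ 2 - (x k 0) ^+ 2) < 0.
Proof.
(* For [q = 0] the sphere is empty, but there is no nonzero [x] either. *)
have [q0|q_gt0] := posnP q.
  exists (fun=> 1) => // x _ /eqP[]; apply/matrixP => i.
  by suff: (i < 0)%N by []; rewrite -q0.
have [d d0 dneg] := block_gain_separation_sphere q_gt0.
have dneg' (x : 'cV[R]_q) : nonneg_mx x -> x != 0 ->
    \sum_k d (b k) * (((G *m x) k 0) ^+ 2 - (x k 0) ^+ 2) < 0.
  move=> x0 xN0; rewrite -sum_block_gain.
  pose s := \sum_i x i 0 ^+ 2.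
  have s0 : 0 < s.
    rewrite lt_def sumr_ge0 ?andbT => [|i _]; last exact: sqr_ge0.
    apply: contraNneq xN0 => s0; apply/eqP/matrixP => i j; rewrite (ord1 j) mxE.
    exact: (sum_sqr_eq0 s0).
  pose a := (Num.sqrt s)^-1.
  have a2 : a ^+ 2 * s = 1 by rewrite exprVn sqr_sqrtr ?ltW // mulVf ?gt_eqF.
  have := dneg (a *: x); rewrite /=.
  under eq_bigr do rewrite mxE exprMn.
  rewrite -mulr_sumr => /(_ _ a2).
  under eq_bigr do rewrite block_gainZ mulrCA.
  rewrite -mulr_sumr pmulr_rlt0; last by rewrite exprn_gt0 // invr_gt0 sqrtr_gt0.
  by apply=> i j; rewrite mxE mulr_ge0 // invr_ge0 sqrtr_ge0.
(* If [d (b k)] were 0, every term at the [k]-th basis vector would be nonnegative. *)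
have db k : 0 < d (b k).
  have := dneg' (delta_mx k 0).
  rewrite (bigD1 k) //= !mxE !eqxx expr1n mulrBr mulr1 => H.
  rewrite lt_neqAle d0 andbT eq_sym; apply/eqP => dk.
  have {H} : 0 < 0 :> R; last by rewrite ltxx.
  apply: le_lt_trans (H _ _) => [|i j|]; last 2 first.
  - by rewrite mxE ler0n.
  - by apply/eqP => /matrixP/(_ k 0); rewrite !mxE !eqxx => /eqP; rewrite oner_eq0.
  rewrite dk mul0r subrr add0r; apply: sumr_ge0 => l /negPf lk.
  by rewrite !mxE lk expr0n subr0 mulr_ge0 ?sqr_ge0.
(* Only a block without coordinates can have weight 0; resetting it to 1 leaves the sum
   unchanged. *)
exists (fun i => if d i == 0 then 1 else d i) => [i|x x0 xN0].
  by have [_|di] := eqVneq (d i) 0; rewrite // lt_neqAle d0 eq_sym di.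
by under eq_bigr do rewrite gt_eqF //; exact: dneg'.
Qed.
End BlockGainSeparation.

(** * Real and imaginary parts of complex matrices, and column eigenvectors *)

Section ComplexParts.
Variable R : realType.

Definition re_mx m n (M : 'M[R[i]]_(m, n)) : 'M[R]_(m, n) := map_mx (fun c => complex.Re c) M.
Definition im_mx m n (M : 'M[R[i]]_(m, n)) : 'M[R]_(m, n) := map_mx (fun c => complex.Im c) M.

Lemma re_mxD m n (M M' : 'M[R[i]]_(m, n)) : re_mx (M + M') = re_mx M + re_mx M'.
Proof. by apply/matrixP => i j; rewrite !mxE; case: (M i j) (M' i j) => ? ? []. Qed.

Lemma im_mxD m n (M M' : 'M[R[i]]_(m, n)) : im_mx (M + M') = im_mx M + im_mx M'.
Proof. by apply/matrixP => i j; rewrite !mxE; case: (M i j) (M' i j) => ? ? []. Qed.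

Lemma re_cplx_mul m n p (A : 'M[R]_(m, n)) (M : 'M_(n, p)) :
  re_mx (cplx_mx A *m M) = A *m re_mx M.
Proof.
apply/matrixP => i j; rewrite !mxE raddf_sum /=; apply: eq_bigr => k _.
by rewrite !mxE; case: (M k j) => a b /=; rewrite mul0r subr0.
Qed.

Lemma im_cplx_mul m n p (A : 'M[R]_(m, n)) (M : 'M_(n, p)) :
  im_mx (cplx_mx A *m M) = A *m im_mx M.
Proof.
apply/matrixP => i j; rewrite !mxE raddf_sum /=; apply: eq_bigr => k _.
by rewrite !mxE; case: (M k j) => a b /=; rewrite mul0r addr0.
Qed.

Lemma re_im_mx_eq0 m n (M : 'M[R[i]]_(m, n)) : re_mx M = 0 -> im_mx M = 0 -> M = 0.
Proof.
move=> /matrixP r0 /matrixP i0; apply/matrixP => i j.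
by have := r0 i j; have := i0 i j; rewrite !mxE; case: (M i j) => a b /= -> ->.
Qed.

Lemma cplx_mx_mul m n p (A : 'M[R]_(m, n)) (B : 'M_(n, p)) :
  cplx_mx (A *m B) = cplx_mx A *m cplx_mx B.
Proof. exact: (map_mxM (real_complex R)). Qed.

Lemma cplx_mxB m n (A B : 'M[R]_(m, n)) : cplx_mx (A - B) = cplx_mx A - cplx_mx B.
Proof. exact: (map_mxB (real_complex R)). Qed.

Lemma cplx_mxD m n (A B : 'M[R]_(m, n)) : cplx_mx (A + B) = cplx_mx A + cplx_mx B.
Proof. exact: (map_mxD (real_complex R)). Qed.

Lemma cplx_mxK m n : cancel (@cplx_mx R m n) (@re_mx m n).
Proof. by move=> M; apply/matrixP => i j; rewrite !mxE. Qed.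

Definition normc2 (c : R[i]) : R := complex.Re c ^+ 2 + complex.Im c ^+ 2.

End ComplexParts.

(** [eigenvalue] refers to row eigenvectors; [M] and [M^T] share their characteristic polynomial. *)
Lemma eigenvalue_colP (K : fieldType) n (M : 'M[K]_n) a :
  reflect (exists2 v : 'cV_n, M *m v = a *: v & v != 0) (eigenvalue M a).
Proof.
have -> : eigenvalue M a = eigenvalue M^T a.
  by rewrite !eigenvalue_root_char /char_poly -det_tr /char_poly_mx linearB /=
    tr_scalar_mx map_trmx.
apply: (iffP eigenvalueP) => -[v Mv v0].
  exists v^T; last by rewrite -trmx0 (inj_eq trmx_inj).
  by apply: trmx_inj; rewrite trmx_mul trmxK Mv linearZ /= trmxK.
exists v^T; last by rewrite -trmx0 (inj_eq trmx_inj).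
by rewrite -trmx_mul Mv linearZ.
Qed.

(** * Coordinates and scalings of block diagonal matrices *)

Section Blocks.
Variables (R : realType) (N : nat) (qs : 'I_N -> nat).
Notation q := (\sum_i qs i)%N.

Lemma sum_Rank (F : 'I_q -> R) :
  \sum_k F k = \sum_i \sum_(j < qs i) F (tagnat.Rank i j).
Proof.
rewrite sig_big_dep /= (reindex _ tagnat.sig_bij_on) /=.
by apply: eq_bigr => k _; rewrite tagnat.sig2K.
Qed.

(** The weight is constant on each block, so the sums split into blockwise contraction bounds. *)
Lemma Delta2_contract (d : 'I_N -> R) (Delta : 'M[R[i]]_q) (z : 'cV_q) :
  (forall i, 0 <= d i) -> Delta2 qs Delta ->
  \sum_k d (tagnat.sig1 k) * normc2 ((Delta *m z) k 0) <=
  \sum_k d (tagnat.sig1 k) * normc2 (z k 0).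
Proof.
move=> d0 [Ds [Ds1 ->]]; rewrite !sum_Rank; apply: ler_sum => i _.
have E (u : 'cV[R[i]]_q) : \sum_(j < qs i) d (tagnat.sig1 (tagnat.Rank i j)) *
    normc2 (u (tagnat.Rank i j) 0) = d i * sqnorm2 (submxcol u i).
  by rewrite mulr_sumr; apply: eq_bigr => j _; rewrite tagnat.Rank1K !mxE.
rewrite !E; apply: ler_wpM2l => //.
by rewrite -{1}[z]submxcolK mul_mxdiag_mxcol mxcolK; exact: Ds1.
Qed.

Lemma mul_mxdiag_scalar (d : 'I_N -> R) m (M : 'M[R]_(q, m)) k j :
  (\mxdiag_i ((d i)%:M : 'M_(qs i)) *m M) k j = d (tagnat.sig1 k) * M k j.
Proof.
rewrite -{1}[M]submxcolK mul_mxdiag_mxcol mxE mul_scalar_mx !mxE.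
by rewrite tagnat.sig2K.
Qed.

(** As a plain diagonal matrix, [D] can be handled entrywise without its block structure. *)
Lemma mxdiag_scalar_diag (d : 'I_N -> R) :
  \mxdiag_i ((d i)%:M : 'M_(qs i)) = diag_mx (\row_k d (tagnat.sig1 k)).
Proof.
rewrite -[LHS]mulmx1; apply/matrixP => k j; rewrite mul_mxdiag_scalar !mxE.
by rewrite mulr_natr.
Qed.

End Blocks.

Lemma quad_diag (R : realType) n (e : 'rV[R]_n) (x y : 'cV_n) :
  (x^T *m diag_mx e *m y) 0 0 = \sum_i e 0 i * (x i 0 * y i 0).
Proof.
rewrite -mulmxA mxE; apply: eq_bigr => i _.
by rewrite mul_diag_mx !mxE mulrCA.
Qed.

(** * Sign rules for products, sums and blocks *)

Section EntrywiseSigns.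
Variable R : realType.

Lemma metzler_block n q (Aul : 'M[R]_n) (Aur : 'M_(n, q)) (Adl : 'M_(q, n)) (Adr : 'M_q) :
  metzler Aul -> nonneg_mx Aur -> nonneg_mx Adl -> metzler Adr ->
  metzler (block_mx Aul Aur Adl Adr).
Proof.
move=> mul nur ndl mdr i j.
case: (split_ordP i) => {}i ->; case: (split_ordP j) => {}j ->;
  rewrite ?(block_mxEul, block_mxEur, block_mxEdl, block_mxEdr) //.
- by rewrite (inj_eq (@lshift_inj _ _)); exact: mul.
- by rewrite (inj_eq (@rshift_inj _ _)); exact: mdr.
Qed.

Lemma nonneg_mulmx m p r (X : 'M[R]_(m, p)) (Y : 'M_(p, r)) :
  nonneg_mx X -> nonneg_mx Y -> nonneg_mx (X *m Y).
Proof. by move=> X0 Y0 i j; rewrite mxE sumr_ge0 // => k _; rewrite mulr_ge0. Qed.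

Lemma nonneg_tr m p (X : 'M[R]_(m, p)) : nonneg_mx X -> nonneg_mx X^T.
Proof. by move=> X0 i j; rewrite mxE. Qed.

Lemma nonnegD m p (X Y : 'M[R]_(m, p)) : nonneg_mx X -> nonneg_mx Y -> nonneg_mx (X + Y).
Proof. by move=> X0 Y0 i j; rewrite mxE addr_ge0. Qed.

Lemma nonneg_diag p (e : 'rV[R]_p) : (forall i, 0 <= e 0 i) -> nonneg_mx (diag_mx e).
Proof. by move=> e0 i j; rewrite mxE mulrn_wge0. Qed.

Lemma nonneg_metzler p (X : 'M[R]_p) : nonneg_mx X -> metzler X.
Proof. by move=> X0 i j _. Qed.

Lemma metzlerD p (X Y : 'M[R]_p) : metzler X -> metzler Y -> metzler (X + Y).
Proof. by move=> mX mY i j ij; rewrite mxE addr_ge0 ?mX ?mY. Qed.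

Lemma metzler_diag_mul p (e : 'rV[R]_p) (X : 'M[R]_p) :
  (forall i, 0 <= e 0 i) -> metzler X -> metzler (diag_mx e *m X).
Proof. by move=> e0 mX i j ij; rewrite mul_diag_mx mxE mulr_ge0 ?mX. Qed.

Lemma metzler_oppdiag p (e : 'rV[R]_p) : metzler (- diag_mx e).
Proof. by move=> i j /negPf ij; rewrite !mxE ij oppr0. Qed.

End EntrywiseSigns.

(** * From the inequalities of (ii) to a dissipation inequality *)

Section Dissipation.
Variables (R : realType) (n q : nat).
Variables (A : 'M[R]_n) (E : 'M[R]_(n, q)) (C : 'M[R]_(q, n)) (F : 'M[R]_q).

(** The final expression is the supply [z^T D z - w^T D w] plus the derivative of the storage
    [x^T P x]; it equals the quadratic form of [Q] at [(x, w)]. *)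
Lemma dissipation (lam mu : 'cV[R]_n) (nu : 'cV[R]_q) (e : 'rV[R]_q) :
  metzler A -> nonneg_mx E -> nonneg_mx C -> nonneg_mx F ->
  pos_mx lam -> pos_mx mu -> pos_mx nu -> (forall i, 0 <= e 0 i) ->
  neg_mx (A *m lam + E *m nu) ->
  let D := diag_mx e in
  neg_mx ((col_mx lam nu)^T *m block_mx (C^T *m D *m C) (C^T *m D *m F)
                             (F^T *m D *m C) (F^T *m D *m F - D)
                  + mu^T *m row_mx A E) ->
  exists2 p : 'rV[R]_n, (forall i, 0 < p 0 i) &
    forall (x : 'cV_n) (w : 'cV_q), col_mx x w != 0 ->
      \sum_k e 0 k * ((C *m x + F *m w) k 0 ^+ 2 - w k 0 ^+ 2) +
      2 * \sum_i p 0 i * (x i 0 * (A *m x + E *m w) i 0) < 0.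
Proof.
move=> mA E0 C0 F0 lam0 mu0 nu0 e0 neg1 D neg2.
pose p : 'rV[R]_n := \row_i (mu i 0 / lam i 0).
have p0 i : 0 < p 0 i by rewrite mxE divr_gt0.
exists p => // x w xw0.
pose P := diag_mx p.
have sD : D^T = D by rewrite tr_diag_mx.
have sP : P^T = P by rewrite tr_diag_mx.
pose Q := block_mx (C^T *m D *m C + (P *m A + A^T *m P)) (C^T *m D *m F + P *m E)
                   (F^T *m D *m C + E^T *m P) (F^T *m D *m F - D).
have D0 : nonneg_mx D by apply: nonneg_diag.
have P0 : nonneg_mx P by apply: nonneg_diag => i; apply/ltW.
have mQ : metzler Q.
  have [CT0 FT0 ET0] : [/\ nonneg_mx C^T, nonneg_mx F^T & nonneg_mx E^T] by split; apply: nonneg_tr.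
  apply: metzler_block.
  - apply: metzlerD; first by apply: nonneg_metzler; do 2?apply: nonneg_mulmx.
    have mPA : metzler (P *m A) by apply: metzler_diag_mul => // i; apply/ltW.
    apply: metzlerD => //.
    by rewrite -[A^T *m P]trmxK trmx_mul trmxK sP; apply: metzler_tr.
  - by apply: nonnegD; do 2?apply: nonneg_mulmx.
  - by apply: nonnegD; do 2?apply: nonneg_mulmx.
  - apply: metzlerD; last exact: metzler_oppdiag.
    by apply: nonneg_metzler; do 2?apply: nonneg_mulmx.
have sQ : Q^T = Q.
  rewrite tr_block_mx !linearD /= linearN /= !trmx_mul !trmxK sD sP !mulmxA.
  by congr (block_mx (_ + _) _ _ _); rewrite addrC.
have lamP : lam^T *m P = mu^T.
  apply/matrixP => i j; rewrite mul_mx_diag !mxE (ord1 i) mulrC divfK //.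
  by rewrite gt_eqF.
(* Since [lam^T P = mu^T], the row [(lam, nu)^T Q] is the second inequality with
   [(A lam + E nu)^T P < 0] added in its first block. *)
have Qv : neg_mx (Q *m col_mx lam nu).
  suff H : neg_mx ((col_mx lam nu)^T *m Q).
    by move=> i j; have := H j i; rewrite -{1}sQ -trmx_mul mxE.
  move: neg2; rewrite tr_col_mx mul_row_block mul_mx_row add_row_mx => neg2.
  rewrite mul_row_block => c i; rewrite (ord1 c) {c}; case: (split_ordP i) => {}i ->.
    rewrite row_mxEl.
    have := neg2 0 (lshift _ i); rewrite row_mxEl => neg3.
    have neg4 : ((A *m lam + E *m nu)^T *m P) 0 i < 0.
      by rewrite mul_mx_diag mxE pmulr_llt0 // mxE; exact: neg1.
    have addE (X Y : 'rV[R]_n) : (X + Y) 0 i = X 0 i + Y 0 i by rewrite mxE.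
    move: neg3 neg4; rewrite [(_ + _)^T]linearD /= !trmx_mul !(mulmxDl, mulmxDr).
    rewrite !mulmxA lamP !addE; lra.
  have addE (X Y : 'rV[R]_q) : (X + Y) 0 i = X 0 i + Y 0 i by rewrite mxE.
  have := neg2 0 (rshift _ i).
  rewrite !row_mxEr !mulmxDr !mulmxA lamP !addE; lra.
have v0 : pos_mx (col_mx lam nu).
  by move=> i j; case: (split_ordP i) => {}i ->; rewrite ?col_mxEu ?col_mxEd.
have := quad_metzler mQ sQ v0 Qv xw0.
set z := C *m x + F *m w; set y := A *m x + E *m w.
have -> : \sum_k e 0 k * (z k 0 ^+ 2 - w k 0 ^+ 2) =
    (z^T *m D *m z) 0 0 - (w^T *m D *m w) 0 0.
  rewrite !quad_diag -sumrB; apply: eq_bigr => k _; rewrite -mulrBr; congr (_ * _); lra.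
rewrite -quad_diag -/P.
have yx : (y^T *m P *m x) 0 0 = (x^T *m P *m y) 0 0.
  by rewrite !quad_diag; apply: eq_bigr => i _; rewrite [x i 0 * _]mulrC.
suff -> : ((col_mx x w)^T *m Q *m col_mx x w) 0 0 =
    (z^T *m D *m z) 0 0 - (w^T *m D *m w) 0 0 + ((x^T *m P *m y) 0 0 + (y^T *m P *m x) 0 0).
  by rewrite yx; lra.
have addE (X Y : 'M[R]_1) : (X + Y) 0 0 = X 0 0 + Y 0 0 by rewrite mxE.
have oppE (X : 'M[R]_1) : (- X) 0 0 = - X 0 0 by rewrite mxE.
rewrite tr_col_mx mul_row_block mul_row_col /z /y !linearD /= !trmx_mul.
rewrite !(mulmxDl, mulmxDr, mulmxN, mulNmx, mulmxA, addE, oppE); lra.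
Qed.
End Dissipation.

(** * Dissipation implies stability for every uncertainty *)

Section Stability.
Variables (R : realType) (n N : nat) (qs : 'I_N -> nat).
Notation q := (\sum_i qs i)%N.
Variables (A : 'M[R]_n) (E : 'M[R]_(n, q)) (C : 'M[R]_(q, n)) (F : 'M[R]_q).

(** One inequality, [key], serves twice: with [x = 0] for the invertibility of [I - F Delta], and
    with [y = a x] for the eigenvalues. *)
Lemma dissipative_stable (d : 'I_N -> R) (p : 'rV[R]_n) (Delta : 'M[R[i]]_q) :
  (forall i, 0 < d i) -> (forall i, 0 < p 0 i) ->
  (forall (x : 'cV_n) (w : 'cV_q), col_mx x w != 0 ->
      \sum_k d (tagnat.sig1 k) * ((C *m x + F *m w) k 0 ^+ 2 - w k 0 ^+ 2) +
      2 * \sum_i p 0 i * (x i 0 * (A *m x + E *m w) i 0) < 0) ->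
  Delta2 qs Delta -> asymp_stable A E C F Delta.
Proof.
move=> d0 p0 diss Del.
have diss0 (x : 'cV_n) (w : 'cV_q) :
    \sum_k d (tagnat.sig1 k) * ((C *m x + F *m w) k 0 ^+ 2 - w k 0 ^+ 2) +
      2 * \sum_i p 0 i * (x i 0 * (A *m x + E *m w) i 0) <= 0.
  have [/eqP|/diss/ltW //] := eqVneq (col_mx x w) 0.
  rewrite col_mx_eq0 => /andP[/eqP -> /eqP ->].
  rewrite !mulmx0 !addr0 !big1 ?mulr0 ?addr0 // => i _; rewrite !mxE ?mul0r ?mulr0 //.
  by rewrite subrr mulr0.
(* The real and imaginary parts satisfy the real inequality separately, one of them strictly; their
   summed supply is nonnegative because [Delta] contracts. *)
have key (x y : 'cV[R[i]]_n) (z : 'cV[R[i]]_q) :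
    z = cplx_mx C *m x + cplx_mx F *m (Delta *m z) ->
    col_mx x (Delta *m z) != 0 ->
    y = cplx_mx A *m x + cplx_mx E *m (Delta *m z) ->
    \sum_i p 0 i * (re_mx x i 0 * re_mx y i 0 + im_mx x i 0 * im_mx y i 0) < 0.
  set w := Delta *m z => zE xw0 yE.
  have c1 := Delta2_contract z (fun i => ltW (d0 i)) Del.
  rewrite -/w in c1.
  have reE := diss0 (re_mx x) (re_mx w); have imE := diss0 (im_mx x) (im_mx w).
  rewrite -!re_cplx_mul -!re_mxD -zE -yE in reE.
  rewrite -!im_cplx_mul -!im_mxD -zE -yE in imE.
  have : col_mx (re_mx x) (re_mx w) != 0 \/ col_mx (im_mx x) (im_mx w) != 0.
    apply/orP; rewrite -negb_and; apply: contraNN xw0.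
    rewrite !col_mx_eq0 => /andP[/andP[/eqP rx /eqP rw] /andP[/eqP ix /eqP iw]].
    by rewrite (re_im_mx_eq0 rx ix) (re_im_mx_eq0 rw iw) !eqxx.
  have sumE : \sum_k d (tagnat.sig1 k) * normc2 (z k 0) - \sum_k d (tagnat.sig1 k) * normc2 (w k 0)
   = \sum_k d (tagnat.sig1 k) * (re_mx z k 0 ^+ 2 - re_mx w k 0 ^+ 2) +
     \sum_k d (tagnat.sig1 k) * (im_mx z k 0 ^+ 2 - im_mx w k 0 ^+ 2).
    rewrite -sumrB -big_split /=; apply: eq_bigr => k _; rewrite !mxE /normc2; ring.
  have -> : \sum_i p 0 i * (re_mx x i 0 * re_mx y i 0 + im_mx x i 0 * im_mx y i 0) =
    \sum_i p 0 i * (re_mx x i 0 * re_mx y i 0) + \sum_i p 0 i * (im_mx x i 0 * im_mx y i 0).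
    by rewrite -big_split /=; apply: eq_bigr => i _; rewrite mulrDr.
  by case=> /diss; rewrite -?re_cplx_mul -?im_cplx_mul -?re_mxD -?im_mxD -zE -yE; lra.
have uM : 1%:M - cplx_mx F *m Delta \in unitmx.
  apply: unitmx_ker0 => z; rewrite mulmxBl mul1mx -mulmxA => /eqP; rewrite subr_eq0 => /eqP zE.
  have [w0|w0] := eqVneq (Delta *m z) 0; first by rewrite zE w0 mulmx0.
  have := key 0 _ z; rewrite mulmx0 add0r -zE => /(_ _ erefl).
  rewrite col_mx_eq0 negb_and w0 orbT => /(_ _ isT erefl).
  by rewrite big1 ?ltxx // => i _; rewrite !mxE /= !mul0r addr0 mulr0.
split=> // a /eigenvalue_colP[x Mx x0].
set z := invmx (1%:M - cplx_mx F *m Delta) *m (cplx_mx C *m x).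
have zE : z = cplx_mx C *m x + cplx_mx F *m (Delta *m z).
  have : (1%:M - cplx_mx F *m Delta) *m z = cplx_mx C *m x by rewrite mulKVmx.
  by rewrite mulmxBl mul1mx -mulmxA => <-; rewrite subrK.
have yE : cplx_mx A *m x + cplx_mx E *m (Delta *m z) = a *: x.
  by rewrite -Mx mulmxDl /z !mulmxA.
have := key x _ z zE; rewrite col_mx_eq0 negb_and x0 => /(_ _ isT (esym yE)).
(* The real part of [conj(x_i) a x_i] is [Re a] times [|x_i|^2]. *)
have -> : \sum_i p 0 i * (re_mx x i 0 * re_mx (a *: x) i 0 + im_mx x i 0 * im_mx (a *: x) i 0) =
  complex.Re a * \sum_i p 0 i * normc2 (x i 0).
  rewrite mulr_sumr; apply: eq_bigr => i _; rewrite !mxE /normc2.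
  by case: a {Mx yE} (x i 0) => a b [u v] /=; ring.
set s := \sum_i _; have s0 : 0 <= s.
  by apply: sumr_ge0 => i _; apply: mulr_ge0; [exact/ltW | rewrite addr_ge0 ?sqr_ge0].
by move=> as0; rewrite ltNge; apply: contraTN as0 => a0; rewrite -leNgt mulr_ge0.
Qed.


(** * Rank one uncertainties and the exclusion of nonnegative gains *)

Lemma sqnorm2E m (v : 'cV[R[i]]_m) :
  sqnorm2 v = \sum_k re_mx v k 0 ^+ 2 + \sum_k im_mx v k 0 ^+ 2.
Proof. by rewrite /sqnorm2 big_split /=; congr (_ + _); apply: eq_bigr => k _; rewrite !mxE. Qed.

Lemma cauchy_schwarz m (u v : 'cV[R]_m) :
  (u^T *m v) 0 0 ^+ 2 <= (\sum_k u k 0 ^+ 2) * \sum_k v k 0 ^+ 2.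
Proof.
have -> : (u^T *m v) 0 0 = \sum_k u k 0 * v k 0.
  by rewrite mxE; apply: eq_bigr => k _; rewrite mxE.
rewrite expr2 !big_distrlr /=.
set S := \sum_i \sum_j (u i 0 ^+ 2 * v j 0 ^+ 2).
have S2 : S = \sum_i \sum_j (u j 0 ^+ 2 * v i 0 ^+ 2) by rewrite /S exchange_big.
have -> : S = (S + S) / 2 by lra.
rewrite {2}S2 -big_split mulr_suml; apply: ler_sum => i _ /=.
rewrite -big_split mulr_suml; apply: ler_sum => j _ /=.
have := sqr_ge0 (u i 0 * v j 0 - u j 0 * v i 0); lra.
Qed.

(* [x z^T / |z|^2] maps [z] to [x]; when [z = 0] the quotient is 0, which is
   right since then [x = 0]. *)
Lemma rank_one_contraction m (x z : 'cV[R]_m) :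
  \sum_k x k 0 ^+ 2 <= \sum_k z k 0 ^+ 2 ->
  exists2 T : 'M[R]_m, l2norm_le1 (cplx_mx T) & T *m z = x.
Proof.
set sx := \sum_k x k 0 ^+ 2; set sz := \sum_k z k 0 ^+ 2 => xz.
have sx0 : 0 <= sx by apply: sumr_ge0 => k _; exact: sqr_ge0.
have sz0 : 0 <= sz by apply: le_trans xz.
pose T := sz^-1 *: (x *m z^T).
have TE (v : 'cV_m) : T *m v = ((z^T *m v) 0 0 / sz) *: x.
  rewrite /T -scalemxAl -mulmxA {1}[z^T *m v]mx11_scalar mul_mx_scalar scalerA.
  by rewrite mulrC.
have zz : (z^T *m z) 0 0 = sz by rewrite mxE; apply: eq_bigr => k _; rewrite mxE expr2.
exists T.
  have bnd (v : 'cV_m) : \sum_k (T *m v) k 0 ^+ 2 <= \sum_k v k 0 ^+ 2.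
    rewrite TE; under eq_bigr do rewrite mxE exprMn; rewrite -mulr_sumr -/sx.
    have v0 : 0 <= \sum_k v k 0 ^+ 2 by apply: sumr_ge0 => k _; exact: sqr_ge0.
    have [sz00|szN0] := eqVneq sz 0; first by rewrite sz00 invr0 mulr0 expr0n mul0r.
    rewrite expr_div_n mulrAC ler_pdivrMr; last by rewrite exprn_even_gt0.
    apply: le_trans (_ : _ <= (sz * \sum_k v k 0 ^+ 2) * sz) _; last by rewrite expr2; lra.
    by apply: ler_pM => //; [exact: sqr_ge0 | exact: cauchy_schwarz].
  by move=> v; rewrite !sqnorm2E re_cplx_mul im_cplx_mul lerD.
rewrite TE zz; have [sz00|szN0] := eqVneq sz 0; last by rewrite divff // scale1r.
rewrite sz00 mul0r scale0r; apply/esym/matrixP => k j; rewrite (ord1 j) mxE.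
by apply: (@sum_sqr_eq0 R _ (fun k => x k 0)); apply/le_anti; rewrite -/sx sx0 -sz00 xz.
Qed.

Lemma rank_one_Delta2 (x z : 'cV[R]_q) :
  (forall i, \sum_j submxcol x i j 0 ^+ 2 <= \sum_j submxcol z i j 0 ^+ 2) ->
  exists2 Delta : 'M[R]_q, Delta2 qs (cplx_mx Delta) & Delta *m z = x.
Proof.
move=> xz; have [T T1 Tz] := fin_all_exists2 (fun i => rank_one_contraction (xz i)).
exists (\mxdiag_i T i); last first.
  rewrite -[in LHS](submxcolK z) mul_mxdiag_mxcol -[RHS]submxcolK.
  exact/eq_mxcol.
exists (fun i => cplx_mx (T i)); split=> //; apply/matrixP => s t; rewrite !mxE.
case: eqVneq => [st|_]; last by rewrite !mxE.
(* Eliminating the equality of block indices turns the size conversion into the identity. *)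
move: (tagnat.sig2 s) (tagnat.sig2 t); case: _ / st => k l.
by rewrite !conform_mx_id mxE.
Qed.

Lemma sum_Rank_block (f : 'I_q -> R) i :
  \sum_(k | tagnat.sig1 k == i) f k = \sum_(j < qs i) f (tagnat.Rank i j).
Proof.
rewrite big_mkcond sum_Rank (bigD1 i) //= [X in _ + X]big1 ?addr0 => [|l li].
  by apply: eq_bigr => j _; rewrite tagnat.Rank1K eqxx.
by apply: big1 => j _; rewrite tagnat.Rank1K (negPf li).
Qed.

(** A [Delta] with [Delta z = x] makes [xs = - A^-1 E x] an equilibrium of the closed loop.
    Stability forces [xs = 0], and then [(I - F Delta) z = 0] gives [z = 0] and [x = 0]. *)
Lemma stable_no_gain (x : 'cV[R]_q) :
  A \in unitmx ->
  (forall Delta, Delta2 qs Delta -> asymp_stable A E C F Delta) ->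
  let z := (F - C *m invmx A *m E) *m x in
  (forall i, 0 <= \sum_(k | tagnat.sig1 k == i) (z k 0 ^+ 2 - x k 0 ^+ 2)) -> x = 0.
Proof.
move=> uA stab z gain.
have [|Delta DD Dz] := @rank_one_Delta2 x z.
  move=> i; rewrite -subr_ge0 -sumrB; have := gain i.
  rewrite sum_Rank_block; congr (0 <= _).
  by apply: eq_bigr => j _; rewrite !mxE.
have [uM hur] := stab _ DD.
pose xs := - (invmx A *m E *m x).
have Axs : A *m xs = - (E *m x) by rewrite mulmxN !mulmxA mulmxV // mul1mx.
have zE : z = C *m xs + F *m x by rewrite /z mulmxBl mulmxN !mulmxA addrC.
have Mz : (1%:M - cplx_mx F *m cplx_mx Delta) *m cplx_mx z = cplx_mx (C *m xs).
  by rewrite mulmxBl mul1mx -mulmxA -!cplx_mx_mul Dz -cplx_mxB zE addrK.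
have cz : cplx_mx z = invmx (1%:M - cplx_mx F *m cplx_mx Delta) *m cplx_mx (C *m xs).
  by rewrite -Mz mulKmx.
have [xs0|xsN0] := eqVneq xs 0.
  rewrite -Dz -[z](@cplx_mxK R) cz xs0 mulmx0.
  have -> : cplx_mx (0 : 'cV[R]_q) = 0 by exact: (map_mx0 (real_complex R)).
  rewrite mulmx0; have -> : re_mx (0 : 'cV[R[i]]_q) = 0 by apply/matrixP => i j; rewrite !mxE.
  by rewrite mulmx0.
have := hur 0; rewrite /= ltxx => H; exfalso.
suff /H : eigenvalue (cplx_mx A + cplx_mx E *m cplx_mx Delta *m
  invmx (1%:M - cplx_mx F *m cplx_mx Delta) *m cplx_mx C) 0 by [].
apply/eigenvalue_colP; exists (cplx_mx xs); last first.
  apply: contra_neq xsN0 => xs0; rewrite -[xs](@cplx_mxK R) xs0.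
  by apply/matrixP => i j; rewrite !mxE.
rewrite scale0r mulmxDl -!mulmxA -(cplx_mx_mul A) -(cplx_mx_mul C) -cz.
rewrite -(cplx_mx_mul Delta) Dz -(cplx_mx_mul E).
rewrite -cplx_mxD Axs addNr; exact: (map_mx0 (real_complex R)).
Qed.
End Stability.

(** * Small perturbations and stable Metzler matrices *)

(** The inverse of any number above all ratios [|r_i| / (- h_i)] works as [e]; their sum plus 1 is
    one. *)
Lemma neg_mx_perturb (R : realType) n (h r : 'rV[R]_n) : neg_mx h ->
  exists2 e : R, 0 < e & neg_mx (h + e *: r).
Proof.
move=> h0; have r0 i : 0 <= `|r 0 i| / - h 0 i by rewrite divr_ge0 // oppr_ge0 ltW.
pose K := 1 + \sum_i `|r 0 i| / - h 0 i.
have K0 : 0 < K by rewrite ltr_pwDl // sumr_ge0.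
exists K^-1 => [|c i]; first by rewrite invr_gt0.
have hi : 0 < - h 0 i by rewrite oppr_gt0.
rewrite (ord1 c) !mxE -[h 0 i]opprK addrC subr_lt0 mulrC ltr_pdivrMr //.
apply: le_lt_trans (ler_norm _) _; rewrite -[ltLHS](divfK (lt0r_neq0 hi)) mulrC.
rewrite ltr_pM2l // /K (bigD1 i) //= addrCA ltrDl.
by rewrite ltr_pwDl // sumr_ge0.
Qed.

(** [A] maps column [j] of [- A^-1] to minus a basis vector, so monotonicity applies. *)
Lemma nonneg_opp_invmx (R : realType) n (A : 'M[R]_n) (lam : 'cV_n) :
  metzler A -> pos_mx lam -> neg_mx (A *m lam) -> nonneg_mx (- invmx A).
Proof.
move=> mA l0 Al i j; have uA := metzler_unit mA l0 Al.
suff : nonneg_mx (col j (- invmx A)) by move=> /(_ i 0); rewrite mxE.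
apply: (metzler_monotone mA l0 Al) => k.
by rewrite colE mulmxA mulmxN mulmxV // mulNmx mul1mx !mxE oppr_le0 ler0n.
Qed.

(** A real kernel vector of [A - t] would be an eigenvector for [t >= 0]. *)
Lemma hurwitz_shift_unit (R : realType) n (A : 'M[R]_n) t :
  hurwitz (cplx_mx A) -> 0 <= t -> A - t%:M \in unitmx.
Proof.
move=> hA t0; apply: unitmx_ker0 => x /eqP.
rewrite mulmxBl mul_scalar_mx subr_eq0 => /eqP Ax.
have [//|xN0] := eqVneq x 0.
have : complex.Re (t%:C)%C < 0.
  apply: hA; apply/eigenvalue_colP; exists (cplx_mx x).
    by rewrite -cplx_mx_mul Ax; apply/matrixP => i j; rewrite !mxE rmorphM.
  apply: contra_neq xN0 => x0; rewrite -[x](@cplx_mxK R) x0.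
  by apply/matrixP => i j; rewrite !mxE.
by rewrite /= ltNge t0.
Qed.

Lemma hurwitz_metzler (R : realType) n (A : 'M[R]_n) :
  metzler A -> hurwitz (cplx_mx A) ->
  [/\ exists2 lam : 'cV_n, pos_mx lam & neg_mx (A *m lam) &
      exists2 mu : 'cV_n, pos_mx mu & neg_mx (A^T *m mu)].
Proof.
move=> mA hA; split; apply: metzler_shift_unit_pos => //.
- by move=> t; exact: hurwitz_shift_unit.
- exact: metzler_tr.
- move=> t t0; have -> : A^T - t%:M = (A - t%:M)^T by rewrite linearB /= tr_scalar_mx.
  by rewrite unitmx_tr; exact: hurwitz_shift_unit.
Qed.

(** * Construction of the certificate from robust stability *)

Section Necessity.
Variables (R : realType) (n N : nat) (qs : 'I_N -> nat).
Notation q := (\sum_i qs i)%N.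
Variables (A : 'M[R]_n) (E : 'M[R]_(n, q)) (C : 'M[R]_(q, n)) (F : 'M[R]_q).
Hypotheses (mA : metzler A) (E0 : nonneg_mx E) (C0 : nonneg_mx C) (F0 : nonneg_mx F).
Hypothesis stab : forall Delta, Delta2 qs Delta -> asymp_stable A E C F Delta.

(** [Delta = 0] is admissible and leaves [A] as the closed loop. *)
Lemma stable_hurwitz : hurwitz (cplx_mx A).
Proof.
have [|_] := stab (Delta := 0).
  exists (fun i => 0); split; last by rewrite mxdiag0.
  move=> i v; rewrite mul0mx /sqnorm2 big1 => [|k _]; last by rewrite mxE /= expr0n addr0.
  by apply: sumr_ge0 => k _; rewrite addr_ge0 ?sqr_ge0.
by rewrite mulmx0 !mul0mx addr0.
Qed.

(** The matrix is Metzler, so invertibility of its nonnegative shifts suffices; a kernel vector of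
    such a shift would make the quadratic form nonnegative. *)
Lemma neg_def_pos_vector (G : 'M[R]_q) (e : 'rV[R]_q) : nonneg_mx G ->
  (forall k, 0 <= e 0 k) ->
  (forall x : 'cV[R]_q, nonneg_mx x -> x != 0 ->
    \sum_k e 0 k * ((G *m x) k 0 ^+ 2 - x k 0 ^+ 2) < 0) ->
  exists2 nu : 'cV[R]_q, pos_mx nu &
    neg_mx ((G^T *m diag_mx e *m G - diag_mx e) *m nu).
Proof.
move=> G0 e0 neg; apply: metzler_shift_unit_pos => [|t t0].
  apply: metzlerD; last exact: metzler_oppdiag.
  by apply: nonneg_metzler; do 2?apply: nonneg_mulmx => //; [exact: nonneg_tr | exact: nonneg_diag].
apply: unitmx_ker0 => x /eqP; rewrite mulmxBl mul_scalar_mx subr_eq0 => /eqP Hx.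
have [//|xN0] := eqVneq x 0.
have : 0 <= (x^T *m ((G^T *m diag_mx e *m G - diag_mx e) *m x)) 0 0.
  rewrite Hx -scalemxAr mxE mulr_ge0 // mxE sumr_ge0 // => k _.
  by rewrite mxE -expr2 sqr_ge0.
have -> : (x^T *m ((G^T *m diag_mx e *m G - diag_mx e) *m x)) 0 0 =
    \sum_k e 0 k * ((G *m x) k 0 ^+ 2 - x k 0 ^+ 2).
  have -> : x^T *m ((G^T *m diag_mx e *m G - diag_mx e) *m x) =
    (G *m x)^T *m diag_mx e *m (G *m x) - x^T *m diag_mx e *m x.
    by rewrite trmx_mul mulmxBl mulmxBr !mulmxA.
  rewrite mxE [X in _ + X]mxE !quad_diag -sumrB; apply: eq_bigr => k _.
  by rewrite -mulrBr -!expr2.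
(* Because [G >= 0], entrywise absolute values can only increase the form, which brings [x] into the
   range of [neg]. *)
rewrite leNgt => /negP[]; pose ax : 'cV[R]_q := \col_k `|x k 0|.
apply: le_lt_trans (neg ax _ _).
- apply: ler_sum => k _; apply: ler_wpM2l => //.
  rewrite [ax k 0]mxE real_normK ?num_real // lerD2r -real_normK ?num_real //.
  rewrite lerXn2r ?nnegrE //.
    by rewrite mxE; apply: sumr_ge0 => j _; rewrite mxE mulr_ge0.
  rewrite !mxE; apply: le_trans (ler_norm_sum _ _ _) _; apply: ler_sum => j _.
  by rewrite mxE normrM ger0_norm.
- by move=> k j; rewrite mxE.
- apply: contra_neq xN0 => ax0; apply/matrixP => k j; rewrite (ord1 j) mxE.
  by move/matrixP/(_ k 0)/eqP: ax0; rewrite !mxE normr_eq0 => /eqP.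
Qed.

Lemma stable_certificate :
  exists (lam mu : 'cV[R]_n) (nu : 'cV[R]_q) (D : 'M[R]_q),
      [/\ pos_mx lam /\ pos_mx mu, pos_mx nu, Dscal qs D,
          neg_mx (A *m lam + E *m nu) &
          neg_mx ((col_mx lam nu)^T *m
                    block_mx (C^T *m D *m C) (C^T *m D *m F)
                             (F^T *m D *m C) (F^T *m D *m F - D)
                  + mu^T *m row_mx A E)].
Proof.
have [[lam0 lam0_gt0 Alam0] [mu0 mu0_gt0 Amu0]] := hurwitz_metzler mA stable_hurwitz.
have uA := metzler_unit mA lam0_gt0 Alam0.
pose B := - invmx A; have B0 : nonneg_mx B by exact: nonneg_opp_invmx mA lam0_gt0 Alam0.
have AB : A *m B = - 1%:M by rewrite mulmxN mulmxV.
have BA : B *m A = - 1%:M by rewrite mulNmx mulVmx.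
(* The static gain from [w] to [z]: the transfer matrix at frequency zero. *)
pose G := F - C *m invmx A *m E.
have GE : G = F + C *m B *m E by rewrite /G /B mulmxN mulNmx.
have G0 : nonneg_mx G by rewrite GE; apply: nonnegD => //; do 2?apply: nonneg_mulmx.
have [d d0 neg] := @block_gain_separation R q N G (@tagnat.sig1 _ _) G0
  (fun x _ gain => stable_no_gain uA stab gain).
clearbody G.
pose e : 'rV[R]_q := \row_k d (tagnat.sig1 k); pose D := diag_mx e.
have [|||nu nu0 Hnu] := @neg_def_pos_vector G e => //.
- by move=> k; rewrite mxE ltW.
- move=> x x0 /(neg x x0); congr (_ < 0).
  by apply: eq_bigr => k _; rewrite [e 0 k]mxE.
rewrite -/D in Hnu.
have sD : D^T = D by rewrite tr_diag_mx.
pose one : 'cV[R]_n := const_mx 1.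
have negH : neg_mx (nu^T *m (G^T *m D *m G - D)).
  move=> i j; suff : (nu^T *m (G^T *m D *m G - D))^T j i < 0 by rewrite mxE.
  by rewrite trmx_mul trmxK linearB /= !trmx_mul trmxK sD mulmxA; exact: Hnu.
(* The perturbing row collects the [eps] terms that [lam] and [mu] will contribute to the second
   block of the certificate. *)
have [eps eps0 small] := neg_mx_perturb ((C *m B *m one)^T *m D *m G + one^T *m B *m E) negH.
pose lam := B *m (E *m nu + eps *: one).
pose z := C *m lam + F *m nu.
pose mu := (B^T *m (C^T *m D *m z + eps *: one)).
have D0 : nonneg_mx D by apply: nonneg_diag => k; rewrite mxE ltW.
have nonneg_pos m p (X : 'M[R]_(m, p)) : pos_mx X -> nonneg_mx X.
  by move=> X0 i j; exact/ltW.
have Alam : A *m lam = - (E *m nu + eps *: one) by rewrite mulmxA AB mulNmx mul1mx.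
have ATmu : A^T *m mu = - (C^T *m D *m z + eps *: one).
  by rewrite mulmxA -trmx_mul BA linearN /= trmx1 mulNmx mul1mx.
have neg_shift (u : 'cV[R]_n) : nonneg_mx u -> neg_mx (- (u + eps *: one)).
  by move=> u0 i j; rewrite !mxE mulr1 oppr_lt0 ltr_wpDl.
have lam_gt0 : pos_mx lam.
  apply: (metzler_monotone_pos mA lam0_gt0 Alam0); rewrite Alam.
  by apply: neg_shift; apply: nonneg_mulmx => //; exact: nonneg_pos.
have z0 : nonneg_mx z by apply: nonnegD; apply: nonneg_mulmx => //; exact: nonneg_pos.
have mu_gt0 : pos_mx mu.
  apply: (metzler_monotone_pos (metzler_tr mA) mu0_gt0 Amu0); rewrite ATmu.
  apply: neg_shift; apply: nonneg_mulmx => //; apply: nonneg_mulmx => //; exact: nonneg_tr.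
(* Eliminating [lam] turns the output [z] into [G nu] plus an [eps] term. *)
have zE : z = G *m nu + eps *: (C *m B *m one).
  rewrite /z /lam GE !(mulmxDl, mulmxDr) -!scalemxAr !mulmxA addrAC.
  by congr (_ + _); exact: addrC.
exists lam, mu, nu, D; split=> //.
- by exists d; rewrite mxdiag_scalar_diag.
- by move=> i j; rewrite Alam opprD addrC addrA subrr add0r !mxE mulr1 oppr_lt0.
have zT : z^T = lam^T *m C^T + nu^T *m F^T by rewrite linearD /= !trmx_mul.
rewrite tr_col_mx mul_row_block mul_mx_row add_row_mx => c i; rewrite (ord1 c) {c}.
case: (split_ordP i) => {}i ->; rewrite ?row_mxEl ?row_mxEr.
- have -> : lam^T *m (C^T *m D *m C) + nu^T *m (F^T *m D *m C) = z^T *m D *m C.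
    by rewrite zT !mulmxDl !mulmxA.
  have -> : mu^T *m A = - (z^T *m D *m C + eps *: one^T).
    rewrite -[A]trmxK -trmx_mul ATmu linearN /= linearD /= linearZ /= !trmx_mul trmxK sD.
    by rewrite mulmxA.
  by rewrite opprD addrA subrr add0r !mxE mulr1 oppr_lt0.
(* Eliminating [lam] and [mu] leaves [nu^T (G^T D G - D)], negative by the choice of [nu], and
   exactly the perturbation controlled by [small]. *)
have -> : lam^T *m (C^T *m D *m F) + nu^T *m (F^T *m D *m F - D) + mu^T *m E =
  nu^T *m (G^T *m D *m G - D) + eps *: ((C *m B *m one)^T *m D *m G + one^T *m B *m E).
  have -> : mu^T = (z^T *m D *m C + eps *: one^T) *m B.
    by rewrite trmx_mul trmxK linearD /= linearZ /= !trmx_mul trmxK sD mulmxA.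
  have -> : lam^T *m (C^T *m D *m F) + nu^T *m (F^T *m D *m F - D) = z^T *m D *m F - nu^T *m D.
    by rewrite zT mulmxBr !mulmxDl !mulmxA addrA.
  have -> : z^T *m D *m F - nu^T *m D + (z^T *m D *m C + eps *: one^T) *m B *m E
     = z^T *m D *m G - nu^T *m D + eps *: (one^T *m B *m E).
    rewrite GE !(mulmxDl, mulmxDr) -!scalemxAl !mulmxA.
    by rewrite addrA [z^T *m D *m F - _ + _]addrAC.
  rewrite zE [(_ + _)^T]linearD /= [(_ *: _)^T]linearZ /= !trmx_mul.
  rewrite mulmxBr !mulmxDl -!scalemxAl scalerDr !mulmxA.
  by rewrite addrA; congr (_ + _); exact: addrAC.
exact: small.
Qed.

End Necessity.

Theorem theorem3 (R : realType) (n N : nat) (qs : 'I_N -> nat)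
  (A : 'M[R]_n) (E : 'M[R]_(n, \sum_i qs i)) (C : 'M[R]_(\sum_i qs i, n))
  (F : 'M[R]_(\sum_i qs i)) :
  metzler A -> nonneg_mx E -> nonneg_mx C -> nonneg_mx F ->
  ((forall Delta, Delta2 qs Delta -> asymp_stable A E C F Delta) <->
   (exists (lam mu : 'cV[R]_n) (nu : 'cV[R]_(\sum_i qs i))
           (D : 'M[R]_(\sum_i qs i)),
      [/\ pos_mx lam /\ pos_mx mu, pos_mx nu, Dscal qs D,
          neg_mx (A *m lam + E *m nu) &
          neg_mx ((col_mx lam nu)^T *m
                    block_mx (C^T *m D *m C) (C^T *m D *m F)
                             (F^T *m D *m C) (F^T *m D *m F - D)
                  + mu^T *m row_mx A E)])).
Proof.
move=> mA E0 C0 F0; split; first exact: stable_certificate.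
move=> [lam [mu [nu [_ [[lam0 mu0] nu0 [d [d0 ->]] neg1]]]]].
rewrite mxdiag_scalar_diag => neg2 Delta DD.
have [|p p0 diss] := dissipation mA E0 C0 F0 lam0 mu0 nu0 _ neg1 neg2.
  by move=> k; rewrite mxE ltW.
apply: (dissipative_stable d0 p0) DD => x w /diss.
congr (_ + _ < 0).
by apply: eq_bigr => k _; rewrite [in LHS]mxE.
Qed.
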